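(* Let $0<\delta\le 1$ and let $A=(a_{ij})$ be an $n\times n$ real symmetric matrix with $\delta\le a_{ij}\le 1$ for all $i,j$. Assume $n\ge 2/(1-\delta)$. Then $$\sum_{\substack{\tau\in T_n:\ \deg_i(\tau)\le 1+3\ln n/(\delta\ln\ln n)\\ \text{for } i=1,\dots,n}}\operatorname{weight}(\tau)\ \ge\ \left(\frac{n-1}{n}\right)\operatorname{spt}A .$$
   Context: $T_n$ is the set of all $n^{n-2}$ spanning trees of the complete undirected graph (no loops, no multiple edges) on vertex set $\{1,\dots,n\}$. For $\tau\in T_n$, $\operatorname{weight}(\tau)=\prod_{\{i,j\}\text{ edge of }\tau}a_{ij}$, and $\operatorname{spt}A=\sum_{\tau\in T_n}\operatorname{weight}(\tau)$. $\deg_i(\tau)$ is the degree of vertex $i$ in the tree $\tau$. *)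

(* Defs.v *)
From HB Require Import structures.
From mathcomp Require Export all_boot all_order all_algebra.
From mathcomp Require Export boolp reals exp.

Set Implicit Arguments.
Unset Strict Implicit.
Unset Printing Implicit Defensive.

Import Order.TTheory GRing.Theory Num.Theory.
Local Open Scope ring_scope.

Section Trees.
Variable T : finType.
(* A graph on the vertex set T is given by its set of edges, each edge being
   a two-element set of vertices. *)
Implicit Types (E : {set {set T}}) (x y : T) (e : {set T}) (c : seq T).

Definition simple_graph E : Prop := forall e, e \in E -> #|e| = 2%N.

Definition adj E : rel T := fun x y => [set x; y] \in E.

Definition connected_graph E : Prop := forall x y, connect (adj E) x y.

Definition acyclic_graph E : Prop :=
  forall c, (2 < size c)%N -> ~~ ucycleb (adj E) c.

Definition is_spanning_tree E : Prop :=
  [/\ simple_graph E, connected_graph E & acyclic_graph E].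

Definition degree E x : nat := #|[set e in E | x \in e]|.

End Trees.

(* The vertices 1, ..., n are numbered 0, ..., n-1. *)
Definition spanning_trees (n : nat) : {set {set {set 'I_n}}} :=
  [set t : {set {set 'I_n}} | `[< is_spanning_tree t >]].

(* Each edge {i, j} is listed once, with i < j; A is meant to be symmetric. *)
Definition weight (R : realType) (n : nat) (A : 'M[R]_n)
    (t : {set {set 'I_n}}) : R :=
  \prod_(p : 'I_n * 'I_n | (p.1 < p.2)%N && ([set p.1; p.2] \in t))
    A p.1 p.2.

Definition spt (R : realType) (n : nat) (A : 'M[R]_n) : R :=
  \sum_(t in spanning_trees n) weight A t.

(* Main.v *)
Require Import Defs.
From HB Require Import structures.
From mathcomp Require Import all_boot all_order all_algebra.
From mathcomp Require Import boolp reals sequences exp ring lra.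
Set Implicit Arguments.
Unset Strict Implicit.
Unset Printing Implicit Defensive.
Import Order.TTheory GRing.Theory Num.Theory.
Local Open Scope ring_scope.

(** Fix a vertex [i] and let [T_k] be the total weight of the trees in which [i]
    has degree [k].  Deleting an edge from a tree leaves a forest [F] in which
    some set [C] of vertices is cut off from [i], and the edges completing [F]
    to a tree are exactly those joining [C] to its complement.  At most [|C|] of
    them are incident to [i], and at least [|C| (n - 1 - |C|)] are not.  Counting
    pairs (tree, edge) through [F], with the pairs whose edge is at [i] weighted
    by [n - 1 - |C|], gives [delta k T_{k+1} <= T_k]: in a tree the sets [C]
    belonging to the edges at [i] are disjoint.  Hence
    [T_{k+1} <= T_1 / (delta^k k!)], a Poisson tail; the exponential moment bound
    at [y = 3 ln n / ln ln n] shows that the degree of [i] is too large on a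
    proportion at most [1 / n^2] of the weight, and a union bound concludes. *)

(** * Exchanging an edge of a spanning tree *)

Section SpanningTreeExchange.
Variable T : finType.
Implicit Types (E F : {set {set T}}) (x y z i : T) (e f g C : {set T}).

Lemma adj_connect_sym E : connect_sym (adj E).
Proof. by apply: sym_connect_sym => x y; rewrite /adj setUC. Qed.

Lemma connect_adjS E F x y :
  E \subset F -> connect (adj E) x y -> connect (adj F) x y.
Proof.
move=> sEF; apply: connect_sub => {x y} x y xy.
by apply: connect1; apply: (subsetP sEF).
Qed.

(** A walk can be cut short so that it crosses the new edge at most once: the cases are no crossing
    and the two directions. *)
Lemma connect_add_edge F a b x y :
  connect (adj ([set a; b] |: F)) x y ->
  [\/ connect (adj F) x y,
      connect (adj F) x a /\ connect (adj F) b y |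
      connect (adj F) x b /\ connect (adj F) a y].
Proof.
case/connectP=> p + ->; elim: p x => [|z p IHp] x /=.
  by move=> _; constructor 1; apply: connect0.
case/andP=> xz /IHp {}IHp; move: xz; rewrite /adj in_setU1 => /orP[|xz].
  move=> /eqP Exz.
  have: x \in [set a; b] by rewrite -Exz set21.
  have: z \in [set a; b] by rewrite -Exz set22.
  have: a \in [set x; z] by rewrite Exz set21.
  have: b \in [set x; z] by rewrite Exz set22.
  rewrite !inE => bxz axz zab xab.
  (* Of the four placements of [x] and [z] on the new edge, the two with [x = z] force [a = b], a
     loop. *)
  case/orP: xab => /eqP xE; case/orP: zab => /eqP zE; subst x z.
  - move: bxz; rewrite orbb => /eqP Eb; subst b.
    by case: IHp => [|[_]|[_]]; constructor 1.
  - by case: IHp => [c|[_ c]|[_ c]];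
      [constructor 2 | constructor 2 | constructor 1]; rewrite ?connect0.
  - by case: IHp => [c|[_ c]|[_ c]];
      [constructor 3 | constructor 1 | constructor 3]; rewrite ?connect0.
  - move: axz; rewrite orbb => /eqP Ea; subst a.
    by case: IHp => [|[_]|[_]]; constructor 1.
have {}xz : connect (adj F) x z by apply: connect1.
case: IHp => [c|[c d]|[c d]]; [constructor 1|constructor 2|constructor 3].
- exact: connect_trans c.
- by split=> //; apply: connect_trans c.
- by split=> //; apply: connect_trans c.
Qed.

Lemma path_del_edge E f z y p :
  z \in f -> z \notin y :: p -> path (adj E) y p -> path (adj (E :\ f)) y p.
Proof.
move=> zf; elim: p y => //= w p IHp y.
rewrite !inE !negb_or => /and3P[zy zw zp] /andP[yw pE].
rewrite IHp ?inE ?negb_or ?zw // andbT /adj in_setD1 [_ \in E]yw andbT.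
by apply: contraTneq zf => <-; rewrite !inE negb_or zy.
Qed.

Lemma upath_del_edge E f z y p :
  z \in f -> uniq [:: z, y & p] -> path (adj E) z (y :: p) ->
  [set z; y] != f -> path (adj (E :\ f)) z (y :: p).
Proof.
move=> zf /andP[zp _] /= /andP[zy pE] nf.
by rewrite (path_del_edge zf) // andbT /adj in_setD1 nf.
Qed.

(* A simple path from [z] has only one edge at [z]. *)
Lemma connect_del_one_of_two E f g z x :
  z \in f -> z \in g -> f != g -> connect (adj E) z x ->
  connect (adj (E :\ f)) z x || connect (adj (E :\ g)) z x.
Proof.
move=> zf zg fg /connectP[p0 + ->]; case/shortenP=> -[|y p] pE Up _.
  by rewrite connect0.
have [Ef|nf] := eqVneq [set z; y] f; apply/orP; [right|left];
  apply/connectP; exists (y :: p) => //; apply: upath_del_edge => //.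
by rewrite Ef.
Qed.

(** A simple path around the edge would close up with it into a cycle; it has at least three
    vertices because the edge itself is deleted. *)
Lemma acyclic_bridge E x y : acyclic_graph E -> x != y -> [set x; y] \in E ->
  ~~ connect (adj (E :\ [set x; y])) x y.
Proof.
move=> acE nxy xyE; apply/negP => /connectP[p0 p0E]; set E' := E :\ _ in p0E.
case/shortenP: p0E => p pE Up _ Ey; have sz : (2 < size (x :: p))%N.
  case: p pE Up Ey => [|w [|v p]] //=; first by move=> _ _ Ey; case/eqP: nxy.
  by rewrite andbT /adj => + _ Ey; rewrite -Ey in_setD1 eqxx.
apply: (negP (acE _ sz)); rewrite /ucycleb Up andbT /= rcons_path -Ey.
rewrite /adj setUC xyE andbT; apply: sub_path pE => u v.
by rewrite /adj in_setD1 => /andP[].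
Qed.

(** The rest of a cycle bypasses its closing edge, which is then no bridge. *)
Lemma bridge_acyclic E :
  (forall x y, x != y -> [set x; y] \in E ->
     ~~ connect (adj (E :\ [set x; y])) x y) -> acyclic_graph E.
Proof.
move=> brE [//|x [//|y p]] sz; apply/negP => /andP[].
rewrite [cycle _ _]/= -[_ && _]/(path (adj E) x (rcons (y :: p) x)) rcons_path.
move=> /andP[pE lx] Up; have xl : x != last x (y :: p).
  by move/andP: Up => [xp _]; apply: contraNneq xp => {1}->; apply: (mem_last y p).
have lE : [set x; last x (y :: p)] \in E by rewrite setUC.
apply: (negP (brE _ _ xl lE)); apply/connectP; exists (y :: p) => //.
apply: upath_del_edge => //; first exact: set21.
(* It remains to see that the path does not start with the closing edge: a cycle on at least three
   distinct vertices does not end at [y]. *)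
case/lastP: p sz Up {pE lx} xl lE => [//|p w] _ Up _ _.
rewrite [last _ _]/= last_rcons; apply/eqP => xyw.
move: Up; rewrite /= !inE mem_rcons !inE rcons_uniq.
have : w \in [set x; y] by rewrite xyw set22.
rewrite !inE => /orP[] /eqP ->; first by rewrite eqxx !orbT.
by rewrite mem_rcons mem_head andbF.
Qed.

(** For a tree minus an edge, this is the component that does not contain [i]. *)
Definition away i F : {set T} := [set x | ~~ connect (adj F) i x].

Definition cut C : {set {set T}} :=
  [set [set x; y] | x in C, y in ~: C].

Lemma cutP C e :
  reflect (exists x y, [/\ x \in C, y \notin C & e = [set x; y]]) (e \in cut C).
Proof.
apply: (iffP imset2P) => [[x y xC yC ->]|[x [y [xC yC ->]]]].
  by exists x, y; rewrite in_setC in yC.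
by exists x y; rewrite ?in_setC.
Qed.

(** Without the bridge [f], the vertex [i] still reaches one endpoint of [f], and hence not the
    other. *)
Lemma tree_edge_cut E f i :
  is_spanning_tree E -> f \in E -> f \in cut (away i (E :\ f)).
Proof.
case=> simE conE acE fE; have /eqP/cards2P[a [b [nab Ef]]] := simE _ fE.
rewrite {f}Ef in fE *; set F := _ :\ _.
have nF : ~~ connect (adj F) a b by apply: acyclic_bridge.
have EF : [set a; b] |: F = E by rewrite setD1K.
have /connect_add_edge ia : connect (adj ([set a; b] |: F)) i a by rewrite EF.
have {ia}: connect (adj F) i a \/ connect (adj F) i b.
  by case: ia => [|[]|[]]; [left|left|right].
case=> [ia|ib]; apply/cutP.
  exists b, a; rewrite !inE ia setUC; split=> //; apply: contraNN nF.
  by apply: connect_trans; rewrite adj_connect_sym.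
exists a, b; rewrite !inE ib; split=> //; apply: contraNN nF => ia.
by rewrite adj_connect_sym in ia; apply: connect_trans ia ib.
Qed.

Lemma cut_away_notin F e i : e \in cut (away i F) -> e \notin F.
Proof.
case/cutP=> x [y []]; rewrite !inE negbK => ix iy ->.
apply: contraNN ix => xyF; apply: connect_trans iy _; apply: connect1.
by rewrite /adj setUC.
Qed.

(** Only one component is cut off: its vertices are all joined to the endpoint [c] of [f], because a
    path from [c] through [f] would link them to [i]. *)
Lemma away_connect E f i x y : is_spanning_tree E -> f \in E ->
  x \in away i (E :\ f) -> y \in away i (E :\ f) ->
  connect (adj (E :\ f)) x y.
Proof.
move=> trE fE; have [_ conE _] := trE.
have /cutP[c [d []]] := tree_edge_cut i trE fE.
set F := _ :\ _; rewrite !inE negbK => ic id Ef ix iy.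
have EF : [set c; d] |: F = E by rewrite -Ef setD1K.
suff cx z : ~~ connect (adj F) i z -> connect (adj F) c z.
  by apply: connect_trans (cx _ iy); rewrite adj_connect_sym; apply: cx.
move=> iz; have: connect (adj ([set c; d] |: F)) c z by rewrite EF.
case/connect_add_edge => [//|[_ dz]|[cd _]].
  by case/negP: iz; apply: connect_trans id dz.
case/negP: ic; apply: connect_trans id _.
by rewrite adj_connect_sym.
Qed.

(** The edge [g] rejoins the two components of [E :\ f]; acyclicity is tested edge by edge with
    [bridge_acyclic]. *)
Lemma tree_exchange E f g i : is_spanning_tree E -> f \in E ->
  g \in cut (away i (E :\ f)) -> is_spanning_tree (g |: E :\ f).
Proof.
move=> trE fE gcut; have gF := cut_away_notin gcut.
have [simE conE acE] := trE.
have awayC := away_connect trE fE.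
case/cutP: gcut => x [y [xC yC Eg]]; set F := _ :\ _ in gF xC yC *.
have xyF : ~~ connect (adj F) x y.
  move: xC yC; rewrite !inE negbK => ix iy; apply: contraNN ix => xy.
  by rewrite adj_connect_sym in xy; apply: connect_trans iy xy.
have sFE : F \subset E by apply: subD1set.
split.
- move=> e; rewrite in_setU1 => /orP[/eqP->|/(subsetP sFE)/simE//].
  by rewrite Eg cards2; case: eqP xC yC => [->|] // ->.
- have sF : F \subset g |: F by apply: subsetUr.
  suff ci z : connect (adj (g |: F)) i z.
    by move=> u v; apply: connect_trans (ci v); rewrite adj_connect_sym.
  have [zC|] := boolP (z \in away i F); last first.
    by rewrite inE negbK; apply: connect_adjS.
  have iy : connect (adj F) i y by move: yC; rewrite inE negbK.
  apply: connect_trans (connect_adjS sF iy) _.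
  have yx : connect (adj (g |: F)) y x.
    by apply: connect1; rewrite /adj setUC -Eg setU11.
  by apply: connect_trans yx (connect_adjS sF _); apply: (awayC i).
- apply: bridge_acyclic => p q npq; rewrite in_setU1 => /orP[/eqP pqg|pqF].
    rewrite pqg setU1K //.
    have := set21 p q; have := set22 p q; rewrite pqg Eg !inE.
    case/orP=> /eqP qE; case/orP=> /eqP pE; subst p q => //;
      by [rewrite eqxx in npq | rewrite adj_connect_sym].
  have pqE := subsetP sFE _ pqF.
  have gpq : g != [set p; q] by apply: contraNneq gF => ->.
  have -> : (g |: F) :\ [set p; q] = g |: F :\ [set p; q].
    by rewrite setDUl; congr (_ :|: _); apply/setDidPl; rewrite disjoints1 inE.
  have sF' : F :\ [set p; q] \subset F by apply: subD1set.
  have pq : connect (adj F) p q by apply: connect1.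
  have qp : connect (adj F) q p by rewrite adj_connect_sym.
  (* A detour around [{p, q}] that avoids [g] already lies in [E]; if it crosses [g], its two halves
     and the edge [{p, q}] join [x] to [y] in [F]. *)
  apply/negP; rewrite Eg => /connect_add_edge[c|[px yq]|[py xq]].
  + move/negP: (acyclic_bridge acE npq pqE); apply.
    by apply: connect_adjS c; apply: setSD.
  + move/connect_adjS: px => /(_ _ sF'); move/connect_adjS: yq => /(_ _ sF').
    rewrite adj_connect_sym => qy; rewrite adj_connect_sym => xp.
    by case/negP: xyF; apply: connect_trans xp (connect_trans pq qy).
  + move/connect_adjS: py => /(_ _ sF') py; move/connect_adjS: xq => /(_ _ sF') xq.
    by case/negP: xyF; apply: connect_trans xq (connect_trans qp py).
Qed.

(** * Counting edges at a vertex and across a cut *)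

Lemma degreeU1 F f i : f \notin F ->
  degree (f |: F) i = ((i \in f) + degree F i)%N.
Proof.
move=> fF; rewrite /degree; have [fi|fi] := boolP (i \in f).
  have -> : [set e in f |: F | i \in e] = f |: [set e in F | i \in e].
    by apply/setP=> e; rewrite !inE; case: eqP => [->|]; rewrite ?fi.
  by rewrite cardsU1 inE (negPf fF).
apply: eq_card => e; rewrite !inE; case: eqP => [->|] //.
by rewrite (negPf fi) !andbF.
Qed.

(** A simple path from [i] uses only one edge at [i], so the sets cut off by different edges at [i]
    are disjoint; none contains [i]. *)
Lemma sum_card_away E i : connected_graph E ->
  (\sum_(f in E | i \in f) #|away i (E :\ f)| <= #|T|.-1)%N.
Proof.
move=> conE; under eq_bigr => f _ do rewrite -sum1_card.
rewrite (exchange_big_dep (predC1 i)) /=; last first.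
  by move=> f x _; rewrite inE; apply: contraNneq => ->; apply: connect0.
rewrite -(cardC1 i) -sum1_card; apply: leq_sum => x _.
rewrite sum1_card; apply/card_le1P => f; rewrite unfold_in => /=.
case/andP=> /andP[fE fi] + g; rewrite inE => ix.
rewrite unfold_in /= !inE; have [->|nfg] := eqVneq g f; first by rewrite fE fi ix.
apply/negP => /andP[/andP[_ gi] jx].
have := connect_del_one_of_two fi gi _ (conE i x).
by rewrite eq_sym (negPf ix) (negPf jx) => /(_ nfg).
Qed.

(** With the tree rooted at [i], sending each edge to its endpoint farther from the root is
    injective and misses the root. *)
Lemma tree_card_edges E i : is_spanning_tree E -> (#|E| <= #|T|.-1)%N.
Proof.
move=> trE; have [_ conE _] := trE.
rewrite -(cardC1 i).
(* The default [i] is never taken on edges of the tree, as [hP] shows. *)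
pose h f := odflt i [pick x | (x \in f) && (x \in away i (E :\ f))].
have hP f : f \in E -> (h f \in f) /\ (h f \in away i (E :\ f)).
  move=> fE; rewrite /h; case: pickP => [x /andP[]//|/= no].
  have /cutP[x [y [xC _ Ef]]] := tree_edge_cut i trE fE.
  by have := no x; rewrite xC andbT {1}Ef set21.
have hinj : {in E &, injective h}.
  move=> f g fE gE hfg; apply/eqP; apply: contraT => nfg.
  have [xf] := hP f fE; have [] := hP g gE; rewrite -hfg !inE => xg ng nf.
  have := connect_del_one_of_two xf xg nfg (conE _ i).
  by rewrite -!(adj_connect_sym _ i) (negPf nf) (negPf ng).
rewrite -(card_in_imset hinj) subset_leq_card //.
apply/subsetP=> _ /imsetP[f fE ->]; rewrite !inE; have [_] := hP f fE.
by rewrite inE; apply: contraNneq => ->; apply: connect0.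
Qed.

Lemma card_cut_at C i :
  i \notin C -> (#|[set f in cut C | i \in f]| <= #|C|)%N.
Proof.
move=> iC; apply: leq_trans (leq_imset_card (fun v => [set i; v]) (mem C)).
apply: subset_leq_card; apply/subsetP => f; rewrite inE => /andP[].
case/cutP=> x [y [xC yC ->]]; rewrite !inE => /orP[] /eqP iE; subst i.
  by rewrite xC in iC.
by apply/imsetP; exists x; rewrite // setUC.
Qed.

(** An edge between [C] and [D] determines its ordered pair, since only one endpoint lies in [C]. *)
Lemma card_cut_off C i : i \notin C ->
  (#|C| * (#|T|.-1 - #|C|) <= #|[set f in cut C | i \notin f]|)%N.
Proof.
move=> iC; pose D := ~: C :\ i.
have cD : #|D| = (#|T|.-1 - #|C|)%N.
  have := cardsC C; rewrite (cardsD1 i (~: C)) inE iC -/D => <-.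
  by rewrite add1n addnS addKn.
rewrite -cD -cardsX.
have inj : {in setX C D &, injective (fun p : T * T => [set p.1; p.2])}.
  move=> [x y] [x' y']; rewrite !inE /= => /and3P[xC yi yC] /and3P[xC' yi' yC'].
  move=> Exy; congr pair.
    have := set21 x y; rewrite Exy !inE => /orP[/eqP//|/eqP xE].
    by rewrite -xE xC in yC'.
  have := set22 x y; rewrite Exy !inE => /orP[/eqP xE|/eqP//].
  by rewrite xE xC' in yC.
rewrite -(card_in_imset inj) subset_leq_card //.
apply/subsetP => _ /imsetP[[x y] + ->]; rewrite !inE /= => /and3P[xC yi yC].
rewrite negb_or eq_sym [i == y]eq_sym yi andbT; apply/andP; split.
  by apply/cutP; exists x, y.
by apply: contraNneq iC => <-.
Qed.

End SpanningTreeExchange.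

(** * Double counting of trees by the degree of a vertex *)

Section DegreeRecursion.
Variables (R : realFieldType) (T : finType) (u : {set T} -> R) (delta : R).
Hypothesis delta_ge0 : 0 <= delta.
Hypothesis u_bnd : forall e : {set T}, #|e| = 2%N -> delta <= u e <= 1.
Implicit Types (E F t : {set {set T}}) (e f : {set T}) (C : {set T}).

(** Convertible to [spanning_trees n] when [T] is ['I_n]. *)
Definition trees : {set {set {set T}}} := [set t | `[< is_spanning_tree t >]].

Definition edge_prod E : R := \prod_(e in E) u e.

Definition tree_sum i k : R :=
  \sum_(t in trees | degree t i == k) edge_prod t.

Lemma edge_prod_ge0 E : simple_graph E -> 0 <= edge_prod E.
Proof.
move=> simE; apply: prodr_ge0 => e /simE/u_bnd/andP[+ _].
exact: le_trans.
Qed.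

Lemma edge_prodD1 E f : f \in E -> edge_prod E = u f * edge_prod (E :\ f).
Proof. by move=> fE; rewrite /edge_prod (big_setD1 f). Qed.

Definition almost_tree F := [exists f, (f \notin F) && (f |: F \in trees)].

(** A completing edge crosses the cut by [tree_edge_cut]; conversely [tree_exchange] trades the
    witness [g] for any edge of the cut. *)
Lemma almost_treeP F i f : almost_tree F ->
  ((f \notin F) && (f |: F \in trees)) = (f \in cut (away i F)).
Proof.
case/existsP=> g /andP[gF]; rewrite !inE => /asboolP trg.
apply/andP/idP => [[fF /asboolP trf]|fcut].
  by have := tree_edge_cut i trf (setU11 _ _); rewrite setU1K.
split; first exact: cut_away_notin fcut.
have := @tree_exchange _ _ g f i trg (setU11 _ _); rewrite setU1K // => trf.
exact/asboolP/trf.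
Qed.

(** Trees with a chosen edge correspond to almost-trees with a completing edge, through
    [(t, f) -> (t :\ f, f)]. *)
Lemma sum_tree_edges i (Q : {set {set T}} -> {set T} -> bool)
    (phi : {set {set T}} -> {set T} -> R) :
  \sum_(t in trees) \sum_(f in t | Q (t :\ f) f) phi (t :\ f) f =
  \sum_(F | almost_tree F) \sum_(f in cut (away i F) | Q F f) phi F f.
Proof.
rewrite !pair_big_dep /=.
rewrite (reindex_onto (fun p => (p.2 |: p.1, p.2)) (fun p => (p.1 :\ p.2, p.2)))
  /=; last by case=> t f /= /and3P[_ ft _]; rewrite setD1K.
(* Adding and then deleting [f] restores [F] exactly when [f] was not in [F]. *)
have condE (p : {set {set T}} * {set T}) :
  (((p.2 |: p.1) :\ p.2, p.2) == p) = (p.2 \notin p.1).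
  case: p => F f /=; rewrite xpair_eqE eqxx andbT.
  have [fF|fF] := boolP (f \in F); last by rewrite setU1K // eqxx.
  by apply/eqP => /setP/(_ f); rewrite !inE eqxx fF.
apply: eq_big => [[F f]|[F f]]; rewrite condE /=; last first.
  by case/andP=> _ fF; rewrite setU1K.
rewrite setU11 /= -andbA andbC -andbA.
have [aF|] := boolP (almost_tree F).
  rewrite -(almost_treeP i f aF).
  by have [fF|fF] := boolP (f \in F); rewrite ?andbF //= setU1K // andbC.
rewrite negb_exists => /forallP/(_ f); rewrite negb_and negbK.
have [fF|fF] := boolP (f \in F); rewrite ?andbF //=.
by move=> /negPf ->; rewrite ?andbF.
Qed.

Lemma treesP t : t \in trees -> is_spanning_tree t.
Proof. by rewrite inE => /asboolP. Qed.

(** The chain [delta * (N * k) * tree_sum i k.+1 <= delta * S1 <= S2 <= N * tree_sum i k] is divided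
    by [N]. *)
Lemma tree_sum_step i k : (1 < #|T|)%N ->
  delta * k%:R * tree_sum i k.+1 <= tree_sum i k.
Proof.
move=> T_gt1; set N := #|T|.-1.
have N_gt0 : (0 < N%:R :> R) by rewrite ltr0n /N -ltnS prednK // ltnW.
pose phi F f := edge_prod F * u f.
have phiE t f : f \in t -> phi (t :\ f) f = edge_prod t.
  by move=> ft; rewrite /phi mulrC -edge_prodD1.
have degE t f : f \in t -> degree t i = ((i \in f) + degree (t :\ f) i)%N.
  by move=> ft; rewrite -{1}(setD1K ft) degreeU1 // !inE eqxx.
(* The subtraction does not truncate, since [away i F] omits [i]. *)
pose m F := (N - #|away i F|)%N.
(* In both sums the forest has degree [k] at [i], so [S1] sees trees of degree [k.+1] and [S2] trees
   of degree [k]. *)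
pose S1 := \sum_(t in trees)
  \sum_(f in t | (i \in f) && (degree (t :\ f) i == k))
    phi (t :\ f) f * (m (t :\ f))%:R.
pose S2 := \sum_(t in trees)
  \sum_(f in t | (i \notin f) && (degree (t :\ f) i == k)) phi (t :\ f) f.
have S1_ge : (N * k)%:R * tree_sum i k.+1 <= S1.
  rewrite /S1 /tree_sum big_mkcondr mulr_sumr /=.
  apply: ler_sum => t tt; have [simt cont _] := treesP tt.
  have Wt := edge_prod_ge0 simt.
  rewrite (eq_bigl (fun f => (f \in t) && (i \in f) && (degree t i == k.+1)));
    last first.
    move=> f /=; case: (boolP (f \in t)) => //= ft; rewrite (degE _ _ ft).
    by case: (i \in f).
  rewrite (eq_bigr (fun f => edge_prod t * (m (t :\ f))%:R)); last first.
    by move=> f /andP[/andP[ft _] _]; rewrite phiE.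
  case: eqP => [dk|_]; last by rewrite mulr0 big_pred0 // => f; rewrite andbF.
  under eq_bigl do rewrite andbT.
  rewrite -mulr_sumr mulrC ler_wpM2l // -natr_sum ler_nat.
  (* Each of the [k.+1] edges at [i] contributes [N] in total; removing the cut-off sizes, which sum
     to at most [N], leaves at least [N * k]. *)
  have: (\sum_(f in t | i \in f) (m (t :\ f) + #|away i (t :\ f)|)
         = k.+1 * N)%N.
    rewrite (eq_bigr (fun=> N)) => [|f _]; last first.
      apply: subnK; rewrite /N -(cardC1 i); apply: subset_leq_card.
      by apply/subsetP => x; rewrite !inE; apply: contraNneq => ->.
    rewrite sum_nat_const -dk; congr (_ * _)%N.
    by apply: eq_card => f; rewrite !inE.
  rewrite big_split /= mulSn [(N + _)%N]addnC mulnC => Esum.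
  by rewrite -(leq_add2r N) -Esum leq_add2l sum_card_away.
have S2_le : S2 <= N%:R * tree_sum i k.
  rewrite /S2 /tree_sum big_mkcondr mulr_sumr /=.
  apply: ler_sum => t tt; have trt := treesP tt; have [simt _ _] := trt.
  have Wt := edge_prod_ge0 simt.
  rewrite (eq_bigl (fun f => (f \in t) && (i \notin f) && (degree t i == k)));
    last first.
    move=> f /=; case: (boolP (f \in t)) => //= ft; rewrite (degE _ _ ft).
    by case: (i \in f).
  rewrite (eq_bigr (fun=> edge_prod t)); last first.
    by move=> f /andP[/andP[ft _] _]; rewrite phiE.
  case: eqP => [dk|_]; last by rewrite mulr0 big_pred0 // => f; rewrite andbF.
  rewrite sumr_const -[leLHS]mulr_natl ler_wpM2r // ler_nat.
  apply: leq_trans (tree_card_edges i trt); apply: subset_leq_card.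
  by apply/subsetP => f /andP[/andP[]].
(* Forest by forest, the completing edges at [i] weigh at most [#|C|], the others at least
   [delta * #|C| * m F]. *)
have S12 : delta * S1 <= S2.
  rewrite /S1 /S2 (sum_tree_edges i
    (fun F f => (i \in f) && (degree F i == k)) (fun F f => phi F f * (m F)%:R)).
  rewrite (sum_tree_edges i
    (fun F f => (i \notin f) && (degree F i == k)) phi).
  rewrite mulr_sumr; apply: ler_sum => F aF.
  have [g /andP[gF /treesP[simg _ _]]] := existsP aF.
  have WF : 0 <= edge_prod F.
    by apply: edge_prod_ge0 => e eF; apply: simg; rewrite inE eF orbT.
  case: eqP => [dk|_]; last first.
    by rewrite !big_pred0 ?mulr0 // => f; rewrite !andbF.
  under eq_bigl do rewrite andbT.
  under [leRHS]eq_bigl do rewrite andbT.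
  set C := away i F; have iC : i \notin C by rewrite inE negbK connect0.
  have cut2 f : f \in cut C -> delta <= u f <= 1.
    rewrite -almost_treeP // => /andP[_ /treesP[simf _ _]].
    by apply/u_bnd/simf/setU11.
  have up : \sum_(f in cut C | i \in f) u f <= #|C|%:R.
    apply: (@le_trans _ _ (\sum_(f in cut C | i \in f) 1)).
      by apply: ler_sum => f /andP[/cut2/andP[]].
    rewrite sumr_const ler_nat; apply: leq_trans (card_cut_at iC).
    by rewrite subset_leq_card //; apply/subsetP => f fC; rewrite inE.
  have lo : delta * (#|C| * m F)%:R <= \sum_(f in cut C | i \notin f) u f.
    apply: (@le_trans _ _ (\sum_(f in cut C | i \notin f) delta)); last first.
      by apply: ler_sum => f /andP[/cut2/andP[]].
    rewrite sumr_const -[leRHS]mulr_natr ler_wpM2l // ler_nat.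
    apply: leq_trans (card_cut_off iC) _.
    by rewrite subset_leq_card //; apply/subsetP => f; rewrite inE.
  rewrite /phi -mulr_suml -!mulr_sumr -mulrA mulrCA ler_wpM2l //.
  apply: le_trans lo; rewrite natrM mulrCA mulrC -mulrA ler_wpM2l //.
  by rewrite mulrC ler_wpM2r.
rewrite -(ler_pM2l N_gt0); apply: le_trans S2_le; apply: le_trans S12.
have -> : N%:R * (delta * k%:R * tree_sum i k.+1) =
  delta * ((N * k)%:R * tree_sum i k.+1) by rewrite natrM; ring.
by rewrite ler_wpM2l.
Qed.

(** The iteration stops at degree 1, because the step with [k = 0] only says [0 <= tree_sum i 0]. *)
Lemma tree_sum_le i k : (1 < #|T|)%N ->
  delta ^+ k * k`!%:R * tree_sum i k.+1 <= tree_sum i 1.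
Proof.
move=> T_gt1; elim: k => [|k IHk]; first by rewrite expr0 fact0 !mul1r.
apply: le_trans IHk; rewrite factS natrM exprS.
have -> : delta * delta ^+ k * (k.+1%:R * k`!%:R) * tree_sum i k.+2 =
  delta ^+ k * k`!%:R * (delta * k.+1%:R * tree_sum i k.+2) by ring.
by rewrite ler_wpM2l ?tree_sum_step // mulr_ge0 // exprn_ge0.
Qed.
End DegreeRecursion.

(** * Estimates for the exponential and the tail exponent *)

Section PoissonTail.
Variable R : realType.
Implicit Types x y : R.

Lemma sum_exp_coeff_le x n : 0 <= x -> \sum_(k < n) x ^+ k / k`!%:R <= expR x.
Proof.
move=> x_ge0; rewrite -(big_mkord predT (fun k => x ^+ k / k`!%:R)).
apply: (@nondecreasing_cvgn_le R (series (exp_coeff x))).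
- apply/nondecreasing_seqP => m; rewrite -subr_ge0 seriesSB; exact: exp_coeff_ge0.
- exact: is_cvg_series_exp_coeff.
Qed.

(** The bound [1 + x <= expR x] at [x = - 1 / 6] gives [(6 / 5) ^+ 6 = 2.985984]; with fifths it
    would give [(5 / 4) ^+ 5 > 3]. *)
Lemma expR1_lt3 : expR 1 < 3 :> R.
Proof.
have e6 : expR (1 : R) = (expR (- (1 / 6)))^-1 ^+ 6.
  by rewrite -expRN opprK -expRM_natl; congr expR; field.
have lo : 5 / 6 <= expR (- (1 / 6)) :> R.
  by apply: le_trans (expR_ge1Dx _); lra.
rewrite e6; apply: (@le_lt_trans _ _ ((5 / 6)^-1 ^+ 6)); last by lra.
apply: lerXn2r; rewrite ?nnegrE ?invr_ge0 ?expR_ge0 //; first by lra.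
by rewrite lef_pV2 ?posrE ?expR_gt0 //; lra.
Qed.

(* The constant 3 is what the tangent bound [ln (L / 3) <= L / 3 - 1] needs. *)
Lemma poisson_tail_exponent (delta L M : R) : 0 < delta -> delta <= 1 ->
  0 < L -> M = expR L ->
  let kappa := 3 * M / (delta * L) in let y := 3 * M / L in
  1 <= y /\ expR (y / delta) * expR (- (kappa * ln y)) <= expR (- (2 * M)).
Proof.
move=> d_gt0 d_le1 L_gt0 ME kappa y.
have M_gt0 : 0 < M by rewrite ME expR_gt0.
have y_gt0 : 0 < y by rewrite /y divr_gt0 // mulr_gt0.
have lny : ln y = L - ln (L / 3).
  have -> : y = M / (L / 3) by rewrite /y; field; rewrite gt_eqF.
  rewrite ln_div ?posrE ?divr_gt0 //; by rewrite ME expRK.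
have lnL : ln (L / 3) <= L / 3 - 1.
  rewrite -{1}[L / 3](subrKC 1); apply: le_ln1Dx.
  by rewrite ltrBrDl subrr divr_gt0.
have lny_ge : 1 + 2 / 3 * L <= ln y by rewrite lny; lra.
split.
  rewrite -ler_ln ?posrE // ln1; lra.
rewrite -expRD ler_expR.
(* The exponent becomes [kappa * (1 - ln y)], which is at most
   [- kappa * (2 / 3 * L) = - 2 * M / delta]. *)
have -> : y / delta = kappa by rewrite /kappa /y; field; rewrite !gt_eqF.
have k_ge0 : 0 <= kappa by rewrite divr_ge0 ?mulr_ge0 // ltW.
have : kappa * (2 / 3 * L) <= kappa * (ln y - 1).
  by rewrite ler_wpM2l //; lra.
have -> : kappa * (2 / 3 * L) = 2 * M / delta.
  by rewrite /kappa; field; rewrite !gt_eqF.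
have : 2 * M <= 2 * M / delta.
  by rewrite ler_pdivlMr // ler_piMr // mulr_ge0 // ltW.
nra.
Qed.
End PoissonTail.

(** A Chernoff bound: a tree of degree [k.+1 > 1 + kappa] is charged the factor [y ^+ k * c >= 1],
    where [c] is [y] to the power [- kappa]. By [tree_sum_le] the charges sum to at most an
    exponential series in [y / delta]. *)
Lemma tree_degree_tail (R : realType) (T : finType) (u : {set T} -> R)
    (delta kappa y : R) (i : T) :
  0 < delta -> (forall e : {set T}, #|e| = 2%N -> delta <= u e <= 1) ->
  (1 < #|T|)%N -> 0 <= kappa -> 1 <= y ->
  \sum_(t in trees T | ~~ ((degree t i)%:R <= 1 + kappa)) edge_prod u t <=
  expR (y / delta) * expR (- (kappa * ln y)) * \sum_(t in trees T) edge_prod u t.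
Proof.
move=> d_gt0 u_bnd T_gt1 k_ge0 y_ge1; set c := expR (- _).
have d_ge0 := ltW d_gt0; have y_gt0 : 0 < y by apply: lt_le_trans y_ge1.
have y_ge0 := ltW y_gt0.
have W_ge0 t : t \in trees T -> 0 <= edge_prod u t.
  by move=> /treesP[simt _ _]; apply: (edge_prod_ge0 d_ge0 u_bnd simt).
(* A crude bound on all degrees, which keeps the sum finite. *)
pose M := #|{set T}|.
apply: (@le_trans _ _ (\sum_(k < M) tree_sum u i k.+1 * (y ^+ k * c))).
  under [leRHS]eq_bigr => k _ do rewrite /tree_sum big_mkcondr /= mulr_suml.
  rewrite exchange_big /= big_mkcondr /=; apply: ler_sum => t tt.
  have Wt := W_ge0 _ tt.
  have term_ge0 (k : 'I_M) :
      0 <= (if degree t i == k.+1 then edge_prod u t else 0) * (y ^+ k * c).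
    by case: ifP => _; rewrite mulr_ge0 // mulr_ge0 ?exprn_ge0 ?expR_ge0.
  case: ifP => [|_]; last by apply: sumr_ge0.
  (* Degree 0 is never too large, as [0 <= kappa]. *)
  rewrite -ltNge => bad; case dE: (degree t i) bad => [|k] bad.
    by move: bad; rewrite ltNge addr_ge0.
  have kM : (k < M)%N by rewrite /M -dE max_card.
  rewrite dE in term_ge0; rewrite (bigD1 (Ordinal kM)) //= eqxx.
  apply: (@le_trans _ _ (edge_prod u t * (y ^+ k * c))); last first.
    by rewrite lerDl; apply: sumr_ge0 => j _; apply: (term_ge0 j).
  rewrite ler_peMr // -[y in y ^+ k]lnK ?posrE // -expRM_natl /c -expRD.
  rewrite -[leLHS]expR0 ler_expR.
  rewrite -mulrBl mulr_ge0 ?ln_ge0 // subr_ge0 ltW //.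
  by move: bad; rewrite -natr1 addrC ltrD2r.
have T1_le : tree_sum u i 1 <= \sum_(t in trees T) edge_prod u t.
  rewrite /tree_sum big_mkcondr /=; apply: ler_sum => t tt.
  by case: ifP => // _; apply: W_ge0.
have T1_ge0 : 0 <= tree_sum u i 1.
  by apply: sumr_ge0 => t /andP[tt _]; apply: W_ge0.
apply: (@le_trans _ _ (expR (y / delta) * c * tree_sum u i 1)); last first.
  by rewrite ler_wpM2l // mulr_ge0 // expR_ge0.
have yd_ge0 : 0 <= y / delta by rewrite divr_ge0.
apply: (@le_trans _ _
    ((\sum_(k < M) (y / delta) ^+ k / k`!%:R) * (c * tree_sum u i 1))).
  rewrite mulr_suml; apply: ler_sum => k _.
  have dk_gt0 : 0 < delta ^+ k * k`!%:R.
    by rewrite mulr_gt0 ?exprn_gt0 ?ltr0n ?fact_gt0.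
  have := tree_sum_le d_ge0 u_bnd i k T_gt1; rewrite mulrC -ler_pdivlMr // => le1.
  have -> : (y / delta) ^+ k / k`!%:R * (c * tree_sum u i 1) =
      tree_sum u i 1 / (delta ^+ k * k`!%:R) * (y ^+ k * c).
    by rewrite expr_div_n invfM; ring.
  by rewrite ler_wpM2r // mulr_ge0 ?exprn_ge0 ?expR_ge0.
by rewrite -mulrA ler_wpM2r ?sum_exp_coeff_le // mulr_ge0 ?expR_ge0.
Qed.

(** * From matrix entries to weights of edges *)

Section EdgeWeight.
Variables (R : realType) (n : nat) (A : 'M[R]_n).

(** On a two-element set the product has a single factor, so no ordering of the endpoints has to be
    chosen; on other sets it is the empty product 1. *)
Definition edge_weight (e : {set 'I_n}) : R :=
  \prod_(p : 'I_n * 'I_n | (p.1 < p.2)%N && ([set p.1; p.2] == e)) A p.1 p.2.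

Lemma weight_edge_prod t : weight A t = edge_prod edge_weight t.
Proof.
rewrite /weight (partition_big (fun p => [set p.1; p.2]) (mem t)) /=.
  apply: eq_bigr => e et; apply: eq_bigl => p.
  by case: eqP => [->|]; rewrite ?andbF // et !andbT.
by move=> p /andP[].
Qed.

Lemma edge_weight_bnd (delta : R) (e : {set 'I_n}) :
  (forall i j, delta <= A i j <= 1) -> #|e| = 2%N -> delta <= edge_weight e <= 1.
Proof.
move=> A_bnd /eqP/cards2P[a [b [nab ->]]] {e}.
wlog ab : a b nab / (a < b)%N => [hwlog|].
  have [|ba|/val_inj/eqP] := ltngtP a b; first exact: hwlog.
    by rewrite setUC; apply: hwlog; rewrite // eq_sym.
  by rewrite (negPf nab).
rewrite /edge_weight (big_pred1 (a, b)) // => -[x y] /=.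
rewrite xpair_eqE; apply/andP/andP => [[xy /eqP Exy]|[/eqP-> /eqP->]] //.
have := set21 x y; have := set22 x y; rewrite Exy !inE.
case/orP=> /eqP yE; case/orP=> /eqP xE; subst x y; rewrite ?eqxx //.
- by rewrite ltnn in xy.
- by have := ltn_trans ab xy; rewrite ltnn.
- by rewrite ltnn in xy.
Qed.

End EdgeWeight.

(* The hypothesis n >= 2 / (1 - delta) is stated multiplied out, so that for
   delta = 1 it is satisfied by no n (2 / 0 = +oo), instead of by every n as
   it would be with the convention 2 / 0 = 0. *)
Theorem theorem1p7 (R : realType) (n : nat) (delta : R) (A : 'M[R]_n)
  (delta_gt0 : 0 < delta) (delta_le1 : delta <= 1)
  (A_sym : A^T = A)
  (A_bnd : forall i j : 'I_n, delta <= A i j <= 1)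
  (n_large : 2 <= n%:R * (1 - delta)) :
  \sum_(t in spanning_trees n |
          [forall i : 'I_n, (degree t i)%:R <=
             1 + 3 * ln n%:R / (delta * ln (ln n%:R))])
     weight A t
  >= (n%:R - 1) / n%:R * spt A.
Proof.
(* Since [0 < delta], the bound on [n] is strict, so [n >= 3 > e]; this makes [ln (ln n)]
   positive. *)
have n_gt2 : (2 < n)%N by rewrite -(ltr_nat R); nra.
have n3 : 3 <= n%:R :> R by rewrite ler_nat.
have n_gt0 : 0 < n%:R :> R by rewrite ltr0n ltnW // ltnW.
set M := ln n%:R; set L := ln M.
have nE : n%:R = expR M :> R by rewrite /M lnK.
have M_gt1 : 1 < M.
  by rewrite -ltr_expR -nE; apply: lt_le_trans (expR1_lt3 R) n3.
have L_gt0 : 0 < L by apply: ln_gt0.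
have ME : M = expR L by rewrite /L lnK // posrE; apply: lt_trans M_gt1.
have [y_ge1 tail] := poisson_tail_exponent delta_gt0 delta_le1 L_gt0 ME.
set kappa := 3 * M / (delta * L) in tail *; set y := 3 * M / L in y_ge1 tail.
have kappa_ge0 : 0 <= kappa by rewrite divr_ge0 ?mulr_ge0 //; lra.
have w_bnd (e : {set 'I_n}) : #|e| = 2%N -> delta <= edge_weight A e <= 1.
  exact: edge_weight_bnd.
have W_ge0 t : t \in spanning_trees n -> 0 <= weight A t.
  move=> /treesP[simt _ _]; rewrite weight_edge_prod.
  exact: (edge_prod_ge0 (ltW delta_gt0) w_bnd simt).
have spt_ge0 : 0 <= spt A by apply: sumr_ge0.
pose bad (i : 'I_n) := \sum_(t in spanning_trees n |
  ~~ ((degree t i)%:R <= 1 + kappa)) weight A t.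
have bad_le i : bad i <= spt A / n%:R ^+ 2.
  rewrite /bad /spt; under eq_bigr do rewrite weight_edge_prod.
  under [X in _ <= X / _]eq_bigr do rewrite weight_edge_prod.
  apply: le_trans (tree_degree_tail i delta_gt0 w_bnd _ kappa_ge0 y_ge1) _.
    by rewrite card_ord ltnW.
  rewrite mulrC ler_wpM2l //.
    apply: sumr_ge0 => t tt; rewrite -weight_edge_prod; exact: W_ge0.
  (* Here [expR (- (2 * M))] is [n ^- 2]. *)
  by apply: le_trans tail _; rewrite expRN expRM_natl -nE.
(* Union bound: a tree outside the good set is counted in [bad i] for some [i]. *)
have split_le : spt A <= \sum_(t in spanning_trees n |
    [forall i : 'I_n, (degree t i)%:R <= 1 + kappa]) weight A t + \sum_i bad i.
  rewrite /spt (bigID (fun t => [forall i : 'I_n, (degree t i)%:R <= 1 + kappa])).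
  rewrite lerD2l /bad; under [leRHS]eq_bigr do rewrite big_mkcondr.
  rewrite exchange_big big_mkcondr /=; apply: ler_sum => t tt.
  have tm_ge0 i :
      0 <= (if ~~ ((degree t i)%:R <= 1 + kappa) then weight A t else 0).
    by case: ifP => // _; apply: W_ge0.
  case: ifP => [|_]; last by apply: sumr_ge0.
  rewrite negb_forall => /existsP[i bi].
  by rewrite (bigD1 i) //= bi lerDl; apply: sumr_ge0.
have bads_le : \sum_i bad i <= spt A / n%:R.
  apply: (@le_trans _ _ (\sum_(i < n) spt A / n%:R ^+ 2)); first exact: ler_sum.
  rewrite sumr_const card_ord -mulr_natr le_eqVlt; apply/orP; left; apply/eqP.
  by field; rewrite gt_eqF.
have -> : (n%:R - 1) / n%:R * spt A = spt A - spt A / n%:R.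
  by field; rewrite gt_eqF.
lra.
Qed.
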